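(* Let $G=(V,E,d)$ be a finite directed graph with strictly positive edge costs $d:E\to\mathbb{R}^+$, let $r\in V$ be a root vertex and $\gamma\geq0$ a threshold. At the end of the tight-path algorithm described below, run on $G$, $r$, $\gamma$, the set $R$ contains exactly the tight paths of $G$ for threshold $\gamma$ that start at $r$.
   Context: A path in $G$ is a sequence $(u_1,\ldots,u_k)$, $k\geq1$, with $(u_i,u_{i+1})\in E$ (not necessarily simple); its cost is the sum of its edge costs (0 if $k=1$). A path $p=(u_1,\ldots,u_k)$ is tight (for $\gamma$) if its cost is $\leq\gamma$ and every path obtained by adding one new edge $(u_0,u_1)\in E$ at the start or $(u_k,u_{k+1})\in E$ at the end has cost $>\gamma$. The algorithm: let $d_0=\min\{d(u,r):(u,r)\in E\}$, or $d_0=\infty$ if $r$ has no in-edge. Set $R=\emptyset$. Create a rooted tree $T$ whose single node (its root) represents $r$; each tree node represents one vertex of $G$, and different tree nodes may represent the same vertex. Initialize a stack containing the pair (root of $T$, $0$). While the stack is nonempty: pop the top pair $(x,c)$, where $x$ represents vertex $v$; for each edge $(v,u)\in E$, if $c+d(v,u)\leq\gamma$, create a new tree node $y$ representing $u$ with parent $x$ and push $(y,c+d(v,u))$ onto the stack; after processing all such edges, if nothing was pushed during this iteration and $d_0+c>\gamma$, add to $R$ the path of $G$ formed by the vertices represented along the tree path from the root of $T$ down to $x$. When the stack is empty, return $R$. *)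

(* Defs.v *)
From Stdlib Require Export Relations.Relation_Operators.
From mathcomp Require Export all_boot all_order all_algebra.
From mathcomp Require Export reals constructive_ereal.

Set Implicit Arguments.
Unset Strict Implicit.
Unset Printing Implicit Defensive.

Import Order.TTheory GRing.Theory Num.Theory.
Local Open Scope ring_scope.

(* A weighted digraph is given by a finite type V of vertices, an edge relation
   E (loops allowed) and costs d u v, which are only relevant when E u v. *)

Definition is_path (V : finType) (E : rel V) (p : seq V) : bool :=
  if p is u :: q then path E u q else false.

Definition path_cost (R : realType) (V : finType) (d : V -> V -> R)
    (p : seq V) : R :=
  if p is u :: q then \sum_(c <- pairmap d u q) c else 0.

Definition tight (R : realType) (V : finType) (E : rel V) (d : V -> V -> R)
    (gamma : R) (p : seq V) : Prop :=
  [/\ is_path E p,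
      path_cost d p <= gamma,
      forall u, is_path E (u :: p) -> gamma < path_cost d (u :: p) &
      forall u, is_path E (rcons p u) -> gamma < path_cost d (rcons p u)].

Definition min_in_cost (R : realType) (V : finType) (E : rel V)
    (d : V -> V -> R) (r : V) : \bar R :=
  \big[Order.min/+oo%E]_(u | E u r) (d u r)%:E.

(* Tree nodes are numbered in order of creation, the root being node 0; entry x
   holds the vertex represented by node x and the parent of x, if any. *)
Definition tree (V : finType) := seq (V * option nat).

Definition node_vertex (V : finType) (r : V) (T : tree V) (x : nat) : V :=
  (nth (r, None) T x).1.

Definition node_parent (V : finType) (r : V) (T : tree V) (x : nat)
  : option nat := (nth (r, None) T x).2.

(* The default r of nth is never used on nodes of T. A branch has at most
   size T nodes, so the fuel in root_path is never exhausted. *)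
Fixpoint climb (V : finType) (r : V) (T : tree V) (fuel x : nat) : seq V :=
  match fuel, node_parent r T x with
  | n.+1, Some y => rcons (climb r T n y) (node_vertex r T x)
  | _, _ => [:: node_vertex r T x]
  end.

Definition root_path (V : finType) (r : V) (T : tree V) (x : nat) : seq V :=
  climb r T (size T) x.

Record state (R : realType) (V : finType) := State {
  st_tree : tree V;
  st_stack : seq (nat * R);
  st_result : seq (seq V) }.

Definition init_state (R : realType) (V : finType) (r : V) : state R V :=
  State [:: (r, None)] [:: (0%N, 0)] [::].

(* Examination of the edge (v, u) while processing the pair (x, c), where x
   represents v; the new node gets the first free number, size T. *)
Definition scan_edge (R : realType) (V : finType) (d : V -> V -> R)
    (gamma : R) (x : nat) (v : V) (c : R)
    (TS : tree V * seq (nat * R)) (u : V) : tree V * seq (nat * R) :=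
  let: (T, stk) := TS in
  if c + d v u <= gamma
  then (rcons T (u, Some x), (size T, c + d v u) :: stk)
  else (T, stk).

(* One iteration of the while loop. The order us in which the out-edges of v
   are scanned is arbitrary and may vary between iterations. *)
Inductive step (R : realType) (V : finType) (E : rel V) (d : V -> V -> R)
    (r : V) (gamma : R) : state R V -> state R V -> Prop :=
| Step (T T' : tree V) (x : nat) (c : R) (stk stk' : seq (nat * R))
    (P : seq (seq V)) (us : seq V) :
    perm_eq us (enum (E (node_vertex r T x))) ->
    foldl (scan_edge d gamma x (node_vertex r T x) c) (T, stk) us
      = (T', stk') ->
    step E d r gamma
      (State T ((x, c) :: stk) P)
      (State T' stk'
        (if (stk' == stk) && (gamma%:E < min_in_cost E d r + c%:E)%E
         then root_path r T' x :: P else P)).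

Definition reachable (R : realType) (V : finType) (E : rel V)
    (d : V -> V -> R) (r : V) (gamma : R) : state R V -> Prop :=
  clos_refl_trans_1n (state R V) (step E d r gamma) (init_state R r).

(* No infinite execution. As a step is possible exactly when the stack is
   nonempty, every execution then ends with an empty stack. *)
Definition terminates (R : realType) (V : finType) (E : rel V)
    (d : V -> V -> R) (r : V) (gamma : R) : Prop :=
  Acc (fun s' s => step E d r gamma s s') (init_state R r).

(* Main.v *)
Require Import Defs.

Set Implicit Arguments.
Unset Strict Implicit.
Unset Printing Implicit Defensive.

Import Order.TTheory GRing.Theory Num.Theory.
Local Open Scope ring_scope.

(** A stack entry [(x, c)] stands for the path from the root of the tree to [x],
    a path of cost [c <= gamma] starting at [r]. Every tight path starting at
    [r] either has been returned or extends the path of some stack entry: its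
    prefixes cost at most [gamma], so popping such an entry either pushes the
    next longer prefix or, when the entry is the whole path, returns it.
    With [delta > 0] below all edge costs and [B > #|V|], the sum over the stack
    of [B ^ floor ((gamma - c) / delta)] decreases at each iteration. *)

(** * Costs of paths and of edges *)

Section PathCost.

Variables (R : realType) (V : finType) (E : rel V) (d : V -> V -> R).

Lemma path_cost_cons u v p :
  path_cost d (u :: v :: p) = d u v + path_cost d (v :: p).
Proof. by rewrite /= big_cons. Qed.

Lemma path_cost_rcons u p v :
  path_cost d (u :: rcons p v) = path_cost d (u :: p) + d (last u p) v.
Proof. by rewrite /= -cats1 pairmap_cat big_cat /= big_seq1. Qed.

Lemma path_cost_ge0 u p : (forall u v, E u v -> 0 < d u v) ->
  path E u p -> 0 <= path_cost d (u :: p).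
Proof.
move=> d_gt0; elim: p u => [|v p IHp] u; first by rewrite /= big_nil.
case/andP=> Euv vp; rewrite path_cost_cons addr_ge0 ?IHp //.
exact/ltW/d_gt0.
Qed.

(** The part [s] is traversed by a path from [last u p], hence has nonnegative cost. Correctness,
    unlike termination, uses positive costs only here. *)
Lemma path_cost_prefix u p s : (forall u v, E u v -> 0 < d u v) ->
  path E u (p ++ s) -> path_cost d (u :: p) <= path_cost d (u :: p ++ s).
Proof.
move=> d_gt0; rewrite cat_path => /andP[_ ups].
by rewrite /= pairmap_cat big_cat /= lerDl (path_cost_ge0 d_gt0 ups).
Qed.

(** Exceeding [a] once [c] is added is preserved by minima and true of [+oo], so a root without
    in-edges is no special case. *)
Lemma lt_min_in_cost r (a c : R) :
  (a%:E < min_in_cost E d r + c%:E)%E <-> forall u, E u r -> a < d u r + c.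
Proof.
rewrite /min_in_cost; split=> [lt_a u Eur|lt_a].
  move: lt_a; rewrite (bigD1 u) //=.
  set m := \big[_/_]_(_ | _) _.
  rewrite -lte_fin EFinD => /lt_le_trans; apply.
  by apply: leeD => //; rewrite ge_min lexx.
elim/big_ind: _ => [|x y ltx lty|u Eur].
- exact: ltry.
- by rewrite /Order.min; case: ifP.
- by rewrite -EFinD lte_fin lt_a.
Qed.

Lemma edge_cost_lower_bound : (forall u v, E u v -> 0 < d u v) ->
  exists2 delta : R, 0 < delta & forall u v, E u v -> delta <= d u v.
Proof.
move=> d_gt0.
(* Starting the minimum at 1 keeps it positive when there is no edge. *)
exists (\big[Order.min/1]_(e : V * V | E e.1 e.2) d e.1 e.2).
  elim/big_ind: _ => [|x y x_gt0 y_gt0|e /d_gt0] //.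
  by rewrite lt_min x_gt0.
by move=> u v Euv; rewrite (bigD1 (u, v)) //= ge_min lexx.
Qed.

End PathCost.

(** * The search tree and its branches *)

Section Tree.

Variables (V : finType) (r : V).

(** Creation order puts parents first, so the number of a node bounds its depth and suffices as fuel
    for [climb]. *)
Definition parent_lt (T : tree V) : Prop :=
  forall x y, node_parent r T x = Some y -> (y < x)%N.

Lemma climb_fuel T n m x : parent_lt T -> (x <= n)%N -> (x <= m)%N ->
  climb r T n x = climb r T m x.
Proof.
move=> wfT; elim: n m x => [|n IHn] [|m] x le_xn le_xm //=;
  case Tx: node_parent => [y|] //; have lt_yx := wfT _ _ Tx.
- by move: lt_yx le_xn; case: x {Tx le_xm}.
- by move: lt_yx le_xm; case: x {Tx le_xn}.
- by rewrite (IHn m) // -ltnS (leq_trans lt_yx).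
Qed.

Lemma climb_cat T S n x : parent_lt T -> (x < size T)%N ->
  climb r (T ++ S) n x = climb r T n x.
Proof.
move=> wfT; elim: n x => [|n IHn] x ltx;
  rewrite /= /node_parent /node_vertex nth_cat ltx //.
case Tx: (nth _ T x).2 => [y|] //.
by rewrite IHn // (ltn_trans (wfT _ _ Tx)).
Qed.

(** Appending nodes also raises the fuel, which [climb_fuel] absorbs; thus older stack entries keep
    their paths. *)
Lemma root_path_cat T S x : parent_lt T -> (x < size T)%N ->
  root_path r (T ++ S) x = root_path r T x.
Proof.
move=> wfT ltx; rewrite /root_path climb_cat //.
by apply: climb_fuel; rewrite // ?size_cat ltnW // ltn_addr.
Qed.

Lemma root_path_parent T x y : parent_lt T -> (x < size T)%N ->
  node_parent r T x = Some y ->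
  root_path r T x = rcons (root_path r T y) (node_vertex r T x).
Proof.
move=> wfT ltx Tx; rewrite /root_path.
by rewrite (climb_fuel wfT (ltnW ltx) (leqW (ltnW ltx))) /= Tx.
Qed.

Definition children (x : nat) (us : seq V) : tree V :=
  [seq (u, Some x) | u <- us].

Lemma parent_lt_children T x us : parent_lt T -> (x < size T)%N ->
  parent_lt (T ++ children x us).
Proof.
move=> wfT ltx z y; rewrite /node_parent nth_cat.
case: ltnP => [_|le_Tz]; first exact: wfT.
have [ltz|lez] := ltnP (z - size T) (size us); last first.
  (* Past the end, [nth] yields the default [(r, None)], which has no parent. *)
  by rewrite nth_default // size_map.
rewrite (nth_map r) //= => -[<-]; exact: leq_trans ltx le_Tz.
Qed.

Lemma node_vertex_child T x us i : (i < size us)%N ->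
  node_vertex r (T ++ children x us) (size T + i) = nth r us i.
Proof.
by move=> lti; rewrite /node_vertex nth_cat ltnNge leq_addr addKn (nth_map r).
Qed.

Lemma root_path_child T x us i : parent_lt T -> (x < size T)%N ->
  (i < size us)%N ->
  root_path r (T ++ children x us) (size T + i)
    = rcons (root_path r T x) (nth r us i).
Proof.
move=> wfT ltx lti; have wfT' := parent_lt_children (us := us) wfT ltx.
rewrite (root_path_parent wfT' (y := x)).
- by rewrite node_vertex_child // root_path_cat.
- by rewrite size_cat size_map ltn_add2l.
- by rewrite /node_parent nth_cat ltnNge leq_addr addKn (nth_map r).
Qed.

End Tree.

(** * One iteration of the algorithm *)

Section Algorithm.

#[local] Arguments path_cost : simpl never.

Variables (R : realType) (V : finType) (E : rel V) (d : V -> V -> R).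
Variables (r : V) (gamma : R).

Definition affordable (v : V) (c : R) (us : seq V) : seq V :=
  [seq u <- us | c + d v u <= gamma].

Definition pushed (n : nat) (v : V) (c : R) (us : seq V) : seq (nat * R) :=
  zip (iota n (size us)) [seq c + d v u | u <- us].

(** Nodes are appended in scanning order, but each push lands on top of the stack, hence
    [catrev]. *)
Lemma foldl_scan_edge x v c T stk us :
  foldl (scan_edge d gamma x v c) (T, stk) us =
  (T ++ children x (affordable v c us),
   catrev (pushed (size T) v c (affordable v c us)) stk).
Proof.
elim: us T stk => [|u us IHus] T stk /=; first by rewrite cats0.
case: ifP => _; rewrite IHus //= cat_rcons; congr (_, _).
by rewrite size_rcons.
Qed.

Lemma size_pushed n v c us : size (pushed n v c us) = size us.
Proof. by rewrite size_zip size_iota size_map minnn. Qed.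

Lemma mem_pushed n v c us y e :
  reflect (exists2 i, (i < size us)%N &
             y = (n + i)%N /\ e = c + d v (nth r us i))
          ((y, e) \in pushed n v c us).
Proof.
have nthE i : (i < size us)%N ->
    nth (0%N, 0) (pushed n v c us) i = ((n + i)%N, c + d v (nth r us i)).
  move=> lti; rewrite nth_zip ?size_iota ?size_map //.
  by rewrite nth_iota // (nth_map r).
apply: (iffP (nthP (0%N, 0))) => [[i]|[i lti [-> ->]]].
  by rewrite size_pushed => lti; rewrite nthE // => -[<- <-]; exists i.
by exists i; rewrite ?size_pushed ?nthE.
Qed.

Lemma mem_affordable v c us u : perm_eq us (enum (E v)) ->
  (u \in affordable v c us) = (c + d v u <= gamma) && E v u.
Proof. by move=> us_v; rewrite mem_filter (perm_mem us_v) mem_enum. Qed.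

(** Pushes only lengthen the stack, so comparing the stacks before and after does detect that
    nothing was pushed. *)
Lemma catrev_pushed_eq n v c us stk :
  (catrev (pushed n v c us) stk == stk) = (us == [::]).
Proof.
case: us => [|u us]; first exact: eqxx.
apply/negbTE/eqP => /(congr1 size).
rewrite catrevE size_cat size_rev size_pushed /= => /eqP.
by rewrite -{2}[size stk]add0n eqn_add2r.
Qed.

(** * Termination *)

Definition stack_weight (delta : R) (stk : seq (nat * R)) : nat :=
  (\sum_(xc <- stk) #|V|.+1 ^ Num.truncn ((gamma - xc.2) / delta))%N.

Lemma step_terminates : (forall u v, E u v -> 0 < d u v) ->
  forall st, Acc (fun s' s => step E d r gamma s s') st.
Proof.
move=> d_gt0 st.
have [delta delta_gt0 le_delta] := edge_cost_lower_bound d_gt0.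
have [n] := ubnP (stack_weight delta (st_stack st)).
elim: n st => [|n IHn] st; first by rewrite ltn0.
rewrite ltnS => le_n; constructor=> st' st_st'.
apply: IHn; apply: leq_trans le_n.
case: st st' / st_st' => T T' x c stk stk' P us us_v.
rewrite foldl_scan_edge => -[_ <-] /=.
set v := node_vertex r T x in us_v *; set us' := affordable v c us.
rewrite /stack_weight catrevE big_cat big_cons /= -addSn leq_add2r.
rewrite (perm_big _ (permEl (perm_rev _))) /=.
set m := Num.truncn _.
have le_us' : (size us' <= #|V|)%N.
  rewrite size_filter (leq_trans (count_size _ _)) // (perm_size us_v).
  by rewrite -cardE max_card.
have lt_m xc : xc \in pushed (size T) v c us' ->
    (Num.truncn ((gamma - xc.2) / delta) < m)%N.
  case: xc => y e /mem_pushed[i lti [_ ->]] /=.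
  have := mem_nth r lti; rewrite mem_affordable // => /andP[le_c Evi].
  set w := nth r us' i in le_c Evi *.
  (* Truncation stays below its argument only for nonnegative arguments; affordability of the edge
     ensures this. *)
  have ge0 : 0 <= (gamma - (c + d v w)) / delta.
    by rewrite divr_ge0 ?subr_ge0 // ltW.
  have le1 : (gamma - (c + d v w)) / delta + 1 <= (gamma - c) / delta.
    rewrite -[X in _ + X <= _](divff (lt0r_neq0 delta_gt0)) -mulrDl.
    rewrite ler_pM2r ?invr_gt0 // opprD addrA -lerBrDr.
    by rewrite lerD2l lerN2 le_delta.
  rewrite /m truncn_gt_nat -natr1; apply: le_trans le1.
  by rewrite lerD2r truncn_le.
(* For exponent 0 nothing was pushed, and the popped entry weighed 1. Otherwise at most [#|V|]
   entries of weight at most [#|V|.+1 ^ m] replace one of weight [#|V|.+1 ^ m.+1]. *)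
case: m lt_m => [|m] lt_m.
  by rewrite big_seq big1 // => xc /lt_m.
apply: (@leq_ltn_trans (size us' * #|V|.+1 ^ m)); last first.
  by rewrite expnS ltn_pmul2r ?expn_gt0 ?ltnS.
rewrite -(size_pushed (size T) v c us') -(sum1_size (pushed _ _ _ _)).
rewrite big_distrl /= !big_seq.
by apply: leq_sum => xc /lt_m; rewrite ltnS mul1n; apply: leq_pexp2l.
Qed.

(** * The loop invariant *)

Definition entry_ok (T : tree V) (xc : nat * R) : Prop :=
  (xc.1 < size T)%N /\
  exists q, [/\ root_path r T xc.1 = r :: q, node_vertex r T xc.1 = last r q,
                path E r q, path_cost d (r :: q) = xc.2 & xc.2 <= gamma].

(** On an empty stack the last two clauses are soundness and completeness of the result; the first
    two make them inductive. *)
Definition state_inv (st : state R V) : Prop :=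
  [/\ parent_lt r (st_tree st),
      forall xc, xc \in st_stack st -> entry_ok (st_tree st) xc,
      forall p, p \in st_result st -> tight E d gamma p /\ ohead p = Some r &
      forall p, tight E d gamma p -> ohead p = Some r ->
        p \in st_result st \/
        exists2 xc, xc \in st_stack st &
          prefix (root_path r (st_tree st) xc.1) p].

Lemma state_inv_init : 0 <= gamma -> state_inv (init_state R r).
Proof.
move=> gamma_ge0; split=> //.
- by move=> [|[|x]].
- move=> xc; rewrite inE => /eqP->; split=> //; exists [::].
  by split=> //=; rewrite /path_cost big_nil.
- move=> [//|u p] _ [->]; right; exists (0%N, 0); first by rewrite inE.
  by rewrite /= eqxx prefix0s.
Qed.

(* Since [c] is the cost of [r :: q], the two tests of the algorithm say that
   [r :: q] has no cheap extension at its end and none at its start. *)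
Lemma tight_tests q c us : path E r q -> path_cost d (r :: q) = c ->
  c <= gamma -> perm_eq us (enum (E (last r q))) ->
  tight E d gamma (r :: q) <->
  (affordable (last r q) c us == [::])
    && (gamma%:E < min_in_cost E d r + c%:E)%E.
Proof.
move=> rq cq lec us_q.
split=> [[_ _ tl tr]|/andP[/eqP us0 /lt_min_in_cost lt_in]].
  apply/andP; split.
    case us_u: affordable => [//|u s].
    have := mem_head u s; rewrite -us_u mem_affordable // => /andP[le_u Eu].
    have := tr u; rewrite /is_path rcons_cons rcons_path rq Eu.
    by rewrite path_cost_rcons cq ltNge le_u => /(_ isT).
  apply/lt_min_in_cost=> u Eur.
  by have := tl u; rewrite path_cost_cons cq /= Eur rq; apply.
split=> //; first by rewrite cq.
- by move=> u /= /andP[Eur _]; rewrite path_cost_cons cq lt_in.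
- move=> u; rewrite rcons_cons path_cost_rcons cq /= rcons_path.
  case/andP=> _ Eu; rewrite ltNge; apply/negP=> le_u.
  by have := mem_affordable c u us_q; rewrite us0 le_u Eu.
Qed.

Lemma state_inv_step st st' : (forall u v, E u v -> 0 < d u v) ->
  step E d r gamma st st' -> state_inv st -> state_inv st'.
Proof.
move=> d_gt0; case=> T T' x c stk stk' P us us_v.
rewrite foldl_scan_edge => -[<- <-] [/= wfT okT sound complete].
have [/= ltx [q [xq vq rq cq lec]]] := okT (x, c) (mem_head _ _).
rewrite vq in us_v *; set us' := affordable _ c us.
(* The test becomes the one of [tight_tests], and the path to be recorded becomes [r :: q]. *)
rewrite catrev_pushed_eq root_path_cat // xq.
have wfT' := parent_lt_children (us := us') wfT ltx.
have tightE := tight_tests rq cq lec us_v; rewrite -/us' in tightE.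
have mem_stk' xc : (xc \in catrev (pushed (size T) (last r q) c us') stk)
    = (xc \in pushed (size T) (last r q) c us') || (xc \in stk).
  by rewrite catrevE mem_cat mem_rev.
split=> //=.
- move=> [y e]; rewrite mem_stk' => /orP[/mem_pushed[i lti [-> ->]]|y_stk].
    have := mem_nth r lti; rewrite mem_affordable // => /andP[le_i Ei].
    split=> /=; first by rewrite size_cat size_map ltn_add2l.
    exists (rcons q (nth r us' i)).
    rewrite root_path_child // xq node_vertex_child // last_rcons rcons_path.
    by rewrite path_cost_rcons cq rq Ei.
  have [/= lty [qy [yq vyq ryq cyq ley]]] : entry_ok T (y, e).
    by apply: okT; rewrite inE y_stk orbT.
  split=> /=; first by rewrite size_cat ltn_addr.
  exists qy; split=> //; first by rewrite root_path_cat.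
  by rewrite /node_vertex nth_cat lty.
- move=> p; case: ifP => [/tightE tq|_]; last exact: sound.
  by rewrite inE => /orP[/eqP->|/sound].
- move=> p tp rp; case: (complete p tp rp) => [pP|[xc]].
    by left; case: ifP => // _; rewrite inE pP orbT.
  rewrite inE => /orP[/eqP->|xc_stk] /=; last first.
    move=> pre_p; right; exists xc; first by rewrite mem_stk' xc_stk orbT.
    have [ltxc _] : entry_ok T xc by apply: okT; rewrite inE xc_stk orbT.
    by rewrite root_path_cat.
  (* The covering entry is popped: either [p] is its whole path and passes both tests, or [p]
     continues with some [u]. *)
  rewrite xq => /prefixP[[|u s] def_p].
    rewrite cats0 in def_p; left; rewrite def_p in tp *.
    by move/tightE: tp => ->; rewrite mem_head.
  right; case: tp => path_p le_p _ _; rewrite def_p /= in path_p le_p.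
  (* Up to [u], the path [p] costs no more than all of [p], hence at most [gamma]. *)
  have u_us' : u \in us'.
    rewrite mem_affordable //; move: (path_p).
    rewrite cat_path /= => /and3P[_ -> _]; rewrite andbT -cq -path_cost_rcons.
    apply: le_trans le_p.
    by rewrite -cat_rcons (path_cost_prefix d_gt0) // cat_rcons.
  have lti : (index u us' < size us')%N by rewrite index_mem.
  (* This is the child created for [u], as children are numbered from [size T] on. *)
  exists ((size T + index u us')%N, c + d (last r q) u).
    rewrite mem_stk'; apply/orP; left; apply/mem_pushed.
    by exists (index u us'); rewrite ?nth_index.
  rewrite root_path_child // xq nth_index // def_p -cat_rcons.
  exact: prefix_prefix.
Qed.

Lemma state_inv_reachable st : (forall u v, E u v -> 0 < d u v) ->
  0 <= gamma -> reachable E d r gamma st -> state_inv st.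
Proof.
move=> d_gt0 /state_inv_init inv0 reach.
(* The closure peels off the first step, so the invariant of the starting state is generalized. *)
elim: reach inv0 => // s s' s'' ss' _ IH.
by move/(state_inv_step d_gt0 ss').
Qed.

End Algorithm.

Theorem theorem3 (R : realType) (V : finType) (E : rel V) (d : V -> V -> R)
    (r : V) (gamma : R)
    (d_gt0 : forall u v : V, E u v -> 0 < d u v)
    (gamma_ge0 : 0 <= gamma) :
  terminates E d r gamma /\
  (forall st : state R V,
     reachable E d r gamma st -> st_stack st = [::] ->
     forall p : seq V,
       p \in st_result st <-> (tight E d gamma p /\ ohead p = Some r)).
Proof.
split=> [|st reach stk0 p]; first exact: step_terminates.
have [_ _ sound complete] := state_inv_reachable d_gt0 gamma_ge0 reach.
split=> [/sound//|[tp rp]].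
by case: (complete p tp rp) => // -[xc]; rewrite stk0.
Qed.
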